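(* For each $i\in\mathbb{Z}^+$ let $\rho_i\in S_{12+2i}$ be the permutation given by $$(\rho_i(1),\rho_i(2),\rho_i(3),\rho_i(4))=(2,3,5,1),$$ $$(\rho_i(9+2i),\rho_i(10+2i),\rho_i(11+2i),\rho_i(12+2i))=(10+2i,\,11+2i,\,12+2i,\,8+2i),$$ and, for $5\le j\le 8+2i$, $\rho_i(j)=j+2$ if $j$ is odd and $\rho_i(j)=j-2$ if $j$ is even. Let $\mathcal{T}_{\rho_i}$ be the catergram of $\rho_i$. Then $\{\mathcal{T}_{\rho_i}: i\in\mathbb{Z}^+\}$ is an antichain with respect to the induced subtanglegram relation $\preceq$; that is, for all distinct $i,j\in\mathbb{Z}^+$ we have $\mathcal{T}_{\rho_i}\not\preceq\mathcal{T}_{\rho_j}$.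
   Context: $[n]=\{1,\dots,n\}$ and $S_n$ is the symmetric group on $[n]$. A rooted tree is a tree with a distinguished vertex, the root; it is binary if every vertex has zero or two children. Leaves are the vertices with no children. Caterpillar: for $n\ge 2$, the rooted caterpillar $C_n$ is the rooted binary tree with $n$ leaves whose $n-1$ internal vertices form a path with the root as an endvertex of this path. Equivalently, it has exactly two leaves at distance $n-1$ from the root and, for each $1\le i\le n-2$, exactly one leaf at distance $i$ from the root. Induced subtree: for a rooted binary tree $T$ with root $r$ and a nonempty subset $B$ of its leaves, $T[B]$ is obtained by taking the smallest subtree $T'$ of $T$ containing $B$, designating as its root the vertex $\rho$ of $T'$ closest to $r$ in $T$, and suppressing all vertices of degree $2$ in $T'$ except $\rho$. Tanglegram: a tanglegram of size $n$ is an ordered triplet $(T_1,T_2,M)$ where $T_1$ (left tree) and $T_2$ (right tree) are rooted binary trees with $n$ leaves each and $M$ is a perfect matching between the two leaf sets. Two tanglegrams are considered the same if there is a graph isomorphism between them (respecting left tree, right tree and matching) that sends the root of the left tree to the root of the left tree and the root of the right tree to the root of the right tree. Induced subtanglegram: for a tanglegram $\mathcal{T}=(T_1,T_2,M)$ and $\emptyset\ne M'\subseteq M$, $\mathcal{T}[M']=(T_1[B_1],T_2[B_2],M')$, where $B_i$ is the set of leaves of $T_i$ matched by $M'$. Write $\mathcal{T}^*\preceq\mathcal{T}$ if $\mathcal{T}^*=\mathcal{T}[M^*]$ (as tanglegrams, i.e. up to a graph isomorphism respecting left tree, right tree and matching that sends the root of the left tree to the root of the left tree and the root of the right tree to the root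 of the right tree) for some $M^*\subseteq M$. Catergram: the distance labeling of the leaves of $C_n$ gives label $i$ to the leaf at distance $i$ from the root for $1\le i\le n-2$, and labels the two leaves at distance $n-1$ arbitrarily by $n-1$ and $n$. For $n\ge 2$ and $\pi\in S_n$, the catergram $\mathcal{T}_\pi$ is the tanglegram $(C_n,C_n,M_\pi)$ in which, with the distance labeling on both caterpillars, the leaf of the left tree labeled $i$ is matched with the leaf of the right tree labeled $j$ if and only if $\pi(i)=j$. *)

(* Defs.v *)
From mathcomp Require Import all_boot perm.
From mathcomp Require Import zify.

Set Implicit Arguments.
Unset Strict Implicit.
Unset Printing Implicit Defensive.

Record rooted_graph := RootedGraph {
  vertex : finType;
  adj : rel vertex;
  root : vertex
}.

Arguments adj : clear implicits.
Arguments root : clear implicits.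

Section Graph.
Variables (V : finType) (e : rel V).

(* Least length of a walk from x to y, and #|V| if there is none (a shortest
   walk visits each vertex at most once, so it has fewer than #|V| edges). *)
Definition dist (x y : V) : nat :=
  find (fun k => [exists p : k.-tuple V, path e x p && (last x p == y)])
       (iota 0 #|V|).

Definition within (S : {set V}) : rel V :=
  [rel x y | [&& x \in S, y \in S & e x y]].

Definition connected_in (S : {set V}) : bool :=
  [forall x in S, forall y in S, connect (within S) x y].

Definition is_tree : Prop :=
  [/\ symmetric e, irreflexive e, forall x y, connect e x y
    & forall c : seq V, 2 < size c -> ~ ucycle e c].

End Graph.

Section RootedTree.
Variable T : rooted_graph.

Definition depth (v : vertex T) : nat := dist (adj T) (root T) v.

Definition children (v : vertex T) : {set vertex T} :=
  [set w | adj T v w && (depth w == (depth v).+1)].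

Definition leaves : {set vertex T} := [set v | children v == set0].

Definition rooted_binary_tree : Prop :=
  is_tree (adj T) /\ forall v, #|children v| = 0 \/ #|children v| = 2.

End RootedTree.

Section Induced.
Variables (T : rooted_graph) (B : {set vertex T}).

(* Subtrees of a tree correspond to its connected vertex sets, and these are
   closed under intersection. *)
Definition hull : {set vertex T} :=
  \bigcap_(S : {set vertex T} | (B \subset S) && connected_in (adj T) S) S.

Definition hull_degree (x : vertex T) : nat :=
  #|[set y in hull | adj T x y]|.

(* The default value of the minimum is only used when B is empty. *)
Definition hull_root : vertex T :=
  [arg min_(x < odflt (root T) [pick b in B] in hull) depth x].

Definition suppressed : {set vertex T} :=
  [set x in hull | (x != hull_root) && (hull_degree x == 2)].

Definition kept : {set vertex T} := hull :\: suppressed.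

(* Suppressing degree-2 vertices leaves an edge between two kept vertices when
   they are the ends of a path of the hull with only suppressed inner vertices;
   equivalently, when suppressed vertices alone suffice to connect them. *)
Definition induced_adj (x y : vertex T) : bool :=
  (x != y) && connect (within (adj T) ([set x; y] :|: suppressed)) x y.

Lemma sub_hull : B \subset hull.
Proof. by apply/bigcapsP => S /andP[]. Qed.

Lemma hull_root_kept : B != set0 -> hull_root \in kept.
Proof.
move=> /set0Pn[b bB]; rewrite !inE.
rewrite /hull_root; case: arg_minnP => [|x xh _].
  case: pickP => [c cB|/(_ b)]; last by rewrite bB.
  exact: (subsetP sub_hull).
by rewrite xh eqxx.
Qed.

Definition induced_subtree (B0 : B != set0) : rooted_graph :=
  @RootedGraph {x : vertex T | x \in kept}
    [rel x y | induced_adj (val x) (val y)]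
    (Sub hull_root (hull_root_kept B0)).

End Induced.

Record pre_tanglegram := PreTanglegram {
  ltree : rooted_graph;
  rtree : rooted_graph;
  matching : {set vertex ltree * vertex rtree}
}.

Arguments matching : clear implicits.

Definition perfect_matching (T1 T2 : rooted_graph)
    (M : {set vertex T1 * vertex T2}) : Prop :=
  [/\ forall x y, (x, y) \in M -> x \in leaves T1 /\ y \in leaves T2,
      forall x, x \in leaves T1 -> exists! y, (x, y) \in M
    & forall y, y \in leaves T2 -> exists! x, (x, y) \in M].

Definition is_tanglegram (T : pre_tanglegram) : Prop :=
  [/\ rooted_binary_tree (ltree T), rooted_binary_tree (rtree T)
    & perfect_matching (matching T)].

(* The number of leaves of the two trees is the same by [perfect_matching]. *)
Record tanglegram := Tanglegram {
  tangle :> pre_tanglegram;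
  tangleP : is_tanglegram tangle
}.

Definition rooted_iso (T1 T2 : rooted_graph) (f : vertex T1 -> vertex T2) :=
  [/\ bijective f, forall x y, adj T2 (f x) (f y) = adj T1 x y
    & f (root T1) = root T2].

Definition tanglegram_iso (T T' : pre_tanglegram) : Prop :=
  exists (f : vertex (ltree T) -> vertex (ltree T'))
         (g : vertex (rtree T) -> vertex (rtree T')),
    [/\ rooted_iso f, rooted_iso g
      & forall x y, ((f x, g y) \in matching T') = ((x, y) \in matching T)].

Section InducedTanglegram.
Variables (T : pre_tanglegram).
Variable M' : {set vertex (ltree T) * vertex (rtree T)}.

Definition left_ends : {set vertex (ltree T)} := [set p.1 | p in M'].
Definition right_ends : {set vertex (rtree T)} := [set p.2 | p in M'].

Lemma left_ends_neq0 : M' != set0 -> left_ends != set0.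
Proof. by move=> /set0Pn[p pM]; apply/set0Pn; exists p.1; apply: imset_f. Qed.

Lemma right_ends_neq0 : M' != set0 -> right_ends != set0.
Proof. by move=> /set0Pn[p pM]; apply/set0Pn; exists p.2; apply: imset_f. Qed.

Definition induced_tanglegram (M0 : M' != set0) : pre_tanglegram :=
  @PreTanglegram (induced_subtree (left_ends_neq0 M0))
    (induced_subtree (right_ends_neq0 M0))
    [set p | (val p.1, val p.2) \in M'].

End InducedTanglegram.

(* Only S and T are required to be tanglegrams: the properties of
   [induced_tanglegram] that make it one follow from those of T. *)
Definition induced_sub (S T : tanglegram) : Prop :=
  exists M' : {set vertex (ltree T) * vertex (rtree T)},
    M' \subset matching T /\
    exists M0 : M' != set0, tanglegram_iso S (induced_tanglegram M0).

Section Caterpillar.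
Variables (n : nat) (n_gt1 : 1 < n).

(* [inl k] is the internal vertex at distance k from the root; [inr k] is the
   leaf with distance label k + 1. *)
Definition cat_vertex : finType := ('I_n.-1 + 'I_n)%type.

(* The leaf labelled k + 1 hangs from the internal vertex at distance k, except
   that the one labelled n hangs from the last internal vertex. *)
Definition cat_parent (u v : cat_vertex) : bool :=
  match u, v with
  | inl a, inl b => b == a.+1 :> nat
  | inl a, inr b => a == minn b n.-2 :> nat
  | _, _ => false
  end.

Definition cat_adj : rel cat_vertex :=
  [rel u v | cat_parent u v || cat_parent v u].

Lemma cat_root_proof : 0 < n.-1.
Proof. by case: n n_gt1 => [|[]]. Qed.

Definition caterpillar : rooted_graph :=
  @RootedGraph cat_vertex cat_adj (inl (Ordinal cat_root_proof)).

Definition cat_depth (v : cat_vertex) : nat :=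
  match v with inl a => a | inr b => minn b.+1 n.-1 end.

Lemma cat_parent_depth u v : cat_parent u v -> cat_depth v = (cat_depth u).+1.
Proof. by case: u v => a [] b //= /eqP; have := ltn_ord b; lia. Qed.

Lemma cat_parent_uniq u u' v : cat_parent u v -> cat_parent u' v -> u = u'.
Proof.
case: u u' v => a [] a' [] b //= /eqP h /eqP h';
  by congr inl; apply: val_inj => /=; lia.
Qed.

Lemma cat_parent_ex v : 0 < cat_depth v -> exists u, cat_parent u v.
Proof.
have := n_gt1; case: v => b /= n1 h; have bn := ltn_ord b.
- have k : b.-1 < n.-1 by lia.
  by exists (inl (Ordinal k)) => /=; apply/eqP; lia.
- have k : minn b n.-2 < n.-1 by lia.
  by exists (inl (Ordinal k)) => /=.
Qed.

Lemma cat_adj_sym : symmetric cat_adj.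
Proof. by move=> u v; rewrite /cat_adj /= orbC. Qed.

Lemma cat_depth0 v : cat_depth v = 0 -> v = root caterpillar.
Proof.
case: v => b /= h; last by have := n_gt1; lia.
by congr inl; apply: val_inj.
Qed.

Lemma cat_walk v : exists p : (cat_depth v).-tuple cat_vertex,
  path cat_adj (root caterpillar) p && (last (root caterpillar) p == v).
Proof.
move ed: (cat_depth v) => d; elim: d v ed => [|d IH] v ed.
  by exists [tuple] => /=; rewrite (cat_depth0 ed).
have [|u uv] := @cat_parent_ex v; first by rewrite ed.
have := cat_parent_depth uv; rewrite ed => -[eu].
have [p /andP[pp /eqP lp]] := IH u (esym eu).
exists [tuple of rcons p v]; rewrite /= rcons_path last_rcons pp lp eqxx.
by rewrite /cat_adj /= uv.
Qed.

Lemma cat_walk_depth x p :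
  path cat_adj x p -> cat_depth (last x p) <= cat_depth x + size p.
Proof.
elim: p x => [|y p IH] x /=; first by rewrite addn0.
case/andP=> /orP[] /cat_parent_depth h /IH le; apply: leq_trans le _; rewrite h.
- by rewrite addSnnS.
- by rewrite leq_add // leqW.
Qed.

Lemma caterpillar_depth v : depth (T := caterpillar) v = cat_depth v.
Proof.
rewrite /depth /dist; set P := (fun k => _).
have lt u : cat_depth u < #|cat_vertex|.
  have n1 := n_gt1; rewrite card_sum !card_ord.
  by case: u => b /=; have := ltn_ord b; lia.
have Pd : P (cat_depth v) by apply/existsP; exact: cat_walk.
have hs : has P (iota 0 #|cat_vertex|).
  by apply/hasP; exists (cat_depth v); rewrite // mem_iota add0n lt.
have := nth_find 0 hs; rewrite -/P.
have := hs; rewrite has_find size_iota => fl.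
rewrite nth_iota // add0n => /existsP[p /andP[pp /eqP lp]].
have := cat_walk_depth pp; rewrite lp size_tuple /= add0n => le1.
apply/eqP; rewrite eqn_leq le1 andbT leqNgt; apply/negP => gt.
by have := before_find 0 gt; rewrite nth_iota // add0n Pd.
Qed.

Lemma caterpillar_children u :
  children (T := caterpillar) u = [set v | cat_parent u v].
Proof.
apply/setP => v; rewrite !inE !caterpillar_depth /= /cat_adj /=.
case uv: (cat_parent u v) => /=; first by rewrite (cat_parent_depth uv) eqxx.
case vu: (cat_parent v u) => //=.
by rewrite (cat_parent_depth vu) ltn_eqF // leqW.
Qed.

Lemma caterpillar_tree : is_tree cat_adj.
Proof.
split=> [||x y|c c2].
- exact: cat_adj_sym.
- by move=> x; rewrite /cat_adj /= orbb; apply/negP => /cat_parent_depth /n_Sn.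
- have cr z : connect cat_adj (root caterpillar) z.
    have [p /andP[pp /eqP <-]] := cat_walk z.
    by apply/connectP; exists p.
  by apply: connect_trans (cr y); rewrite (sym_connect_sym cat_adj_sym).
case/andP=> cc uc.
have [x0 x0c] : exists x, x \in c.
  by case: c c2 {cc uc} => // x c _; exists x; rewrite mem_head.
have [x xc xmax] : exists2 x, x \in c
    & forall y, y \in c -> cat_depth y <= cat_depth x.
  by case: (arg_maxnP (P := mem c) cat_depth x0c) => x xc xm; exists x.
have [k [c' ec]] : exists k c', rot k c = x :: c'.
  by have [k c' e] := rot_to xc; exists k, c'.
have c2' : 2 < size (x :: c') by rewrite -ec size_rot.
have uc' : uniq (x :: c') by rewrite -ec rot_uniq.
have cc' : cycle cat_adj (x :: c') by rewrite -ec rot_cycle.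
have up y : y \in x :: c' -> cat_adj x y -> cat_parent y x.
  rewrite -ec mem_rot => /xmax le /orP[] // /cat_parent_depth e.
  by move: le; rewrite e ltnn.
move: c2' uc' cc' up; case: c' {ec} => [|y c'] //.
case: (lastP c') => [|{}c' z] //= _.
rewrite rcons_path last_rcons => /and3P[xn yn _] /and3P[xy _ zx] up.
have yx := up y; rewrite !inE eqxx orbT in yx.
have zx' := up z; rewrite !inE mem_rcons mem_head !orbT cat_adj_sym in zx'.
have := cat_parent_uniq (yx isT xy) (zx' isT zx) => e.
by move: yn; rewrite e mem_rcons mem_head.
Qed.

Lemma caterpillar_leaves :
  leaves caterpillar = [set v | if v is inr _ then true else false].
Proof.
apply/setP => -[a|a]; rewrite !inE caterpillar_children.
- apply/negbTE/set0Pn; have k : a < n by have := ltn_ord a; lia.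
  exists (inr (Ordinal k)); rewrite inE /=; apply/eqP; have := ltn_ord a; lia.
- by apply/eqP/setP => v; rewrite !inE.
Qed.

Lemma caterpillar_binary : rooted_binary_tree caterpillar.
Proof.
split=> [|[a|a]]; first exact: caterpillar_tree.
- right; rewrite caterpillar_children; have an := ltn_ord a.
  have k : a < n by lia.
  have [lt|ge] := ltnP a.+1 n.-1.
  + have -> : [set v | cat_parent (inl a) v] =
              [set inl (Ordinal lt); inr (Ordinal k)].
      apply/setP => -[b|b]; rewrite !inE /= /eq_op /= -?val_eqE /= ?orbF //.
      by have := ltn_ord b; lia.
    by rewrite cards2.
  + have k' : a.+1 < n by lia.
    have -> : [set v | cat_parent (inl a) v] =
              [set inr (Ordinal k); inr (Ordinal k')].
      apply/setP => -[b|b]; rewrite !inE /= /eq_op /= -?val_eqE /=;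
        by have := ltn_ord b; lia.
    by rewrite cards2 /eq_op /= -val_eqE /= (ltn_eqF (ltnSn a)).
- left; rewrite caterpillar_children; apply/eqP; rewrite cards_eq0.
  by apply/eqP/setP => v; rewrite !inE.
Qed.

Lemma caterpillar_leaf_depth (k : 'I_n) :
  depth (T := caterpillar) (inr k) = minn k.+1 n.-1.
Proof. exact: caterpillar_depth. Qed.

Variable pi : 'S_n.

Definition cat_matching : {set vertex caterpillar * vertex caterpillar} :=
  [set p | if p is (inr a, inr b) then pi a == b else false].

Lemma catergramP : is_tanglegram (PreTanglegram cat_matching).
Proof.
split=> /=; [exact: caterpillar_binary | exact: caterpillar_binary |].
rewrite /perfect_matching caterpillar_leaves; split.
- by move=> [a|a] [b|b]; rewrite !inE.
- move=> [a|a]; rewrite inE // => _; exists (inr (pi a)).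
  split; first by rewrite inE.
  by move=> [b|b]; rewrite inE // => /eqP ->.
- move=> [b|b]; rewrite inE // => _; exists (inr (perm_inv pi b)).
  split; first by rewrite inE permKV.
  by move=> [a|a]; rewrite inE // => /eqP <-; rewrite permK.
Qed.

Definition catergram : tanglegram := Tanglegram catergramP.

End Caterpillar.

(* One-line notation, with positions and values numbered from 1. *)
Definition rho_val (i j : nat) : nat :=
  if j == 1 then 2
  else if j == 2 then 3
  else if j == 3 then 5
  else if j == 4 then 1
  else if j == 9 + 2 * i then 10 + 2 * i
  else if j == 10 + 2 * i then 11 + 2 * i
  else if j == 11 + 2 * i then 12 + 2 * i
  else if j == 12 + 2 * i then 8 + 2 * i
  else if odd j then j + 2 else j - 2.

Lemma rho_val_bound (i j : nat) :
  0 < j <= 12 + 2 * i -> 0 < rho_val i j <= 12 + 2 * i.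
Proof.
rewrite /rho_val => jn; do ![case: eqP => ? //=]; try lia.
case: ifP => ?; lia.
Qed.

Lemma rho_val_inj (i j k : nat) :
  0 < j <= 12 + 2 * i -> 0 < k <= 12 + 2 * i ->
  rho_val i j = rho_val i k -> j = k.
Proof.
rewrite /rho_val => jn kn.
have: (odd j = (j %% 2 == 1)) /\ (odd k = (k %% 2 == 1)).
  by rewrite !modn2; split; case: odd.
case=> -> ->; repeat (case: ifP => ?); lia.
Qed.

Lemma rho_ord_proof (i : nat) (k : 'I_(12 + 2 * i)) :
  (rho_val i k.+1).-1 < 12 + 2 * i.
Proof. by have := @rho_val_bound i k.+1 (ltn_ord k); lia. Qed.

Definition rho_ord (i : nat) (k : 'I_(12 + 2 * i)) : 'I_(12 + 2 * i) :=
  Ordinal (rho_ord_proof k).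

Lemma rho_ord_inj (i : nat) : injective (@rho_ord i).
Proof.
move=> j k /(congr1 val) /= e; apply: val_inj => /=.
have bj := @rho_val_bound i j.+1 (ltn_ord j).
have bk := @rho_val_bound i k.+1 (ltn_ord k).
have : rho_val i j.+1 = rho_val i k.+1 by lia.
by move/(@rho_val_inj i j.+1 k.+1 (ltn_ord j) (ltn_ord k)) => [].
Qed.

(* Ordinals are numbered from 0: the number m of [12 + 2 * i] is the ordinal of
   value m - 1. *)
Definition rho (i : nat) : 'S_(12 + 2 * i) := perm (@rho_ord_inj i).

Lemma rho_size (i : nat) : 1 < 12 + 2 * i.
Proof. by []. Qed.

Definition rho_catergram (i : nat) : tanglegram := catergram (rho_size i) (rho i).

(* Main.v *)
From mathcomp Require Import all_boot perm zify.
Require Import Defs.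

Set Implicit Arguments.
Unset Strict Implicit.
Unset Printing Implicit Defensive.

(** In a caterpillar the position of a leaf is decided by cut vertices. If the
    leaf k hangs strictly closer to the root than the leaf l, then the internal
    vertex just below the parent of k separates the root from l but not from k.
    This survives isomorphisms, and it passes from an induced subtree to the
    hull in the big tree, because suppression does not change which kept
    vertices a kept vertex separates. An embedding of one catergram into another
    thus gives an injection between the matched pairs which preserves the strict
    order of the leaves in both trees ([leaf_order_embedding]); only the two
    lowest leaves of a caterpillar, which an isomorphism may swap, are not
    compared. In particular it preserves the inversions of the permutation in
    which neither order is undetermined in this way ([induced_sub_inversions]).

    With matched pairs as vertices and these inversions as edges, [rho i] gives
    a double broom ([strict_inversion_rho]), a path
<<
        0 - h_0 - 2 - h_1 - 4 - ... - h_m - (2m+2)       with m = i + 3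
>>
    having one more pendant vertex at h_0 and one more at h_m. (The pair with
    the largest left label but one has lost its only inversion to the
    undetermined order, and is isolated.) The hubs h_t are the pairs which are
    the later position of some inversion, so an embedding of the double broom of
    i into that of j sends hubs to hubs. Consecutive hubs, being those with a
    common neighbour, go to consecutive hubs, so the indices perform a self-
    avoiding walk on a line, which must be monotone ([line_walk]). The two end
    hubs are the only ones with three neighbours, so the walk leads from one end
    of the second broom to the other: both brooms have the same length, and i =
    j. *)

(** * Paths and hulls in a caterpillar *)

Lemma connect_within_subset (V : finType) (e : rel V) (A A' : {set V}) x y :
  A \subset A' -> connect (within e A) x y -> connect (within e A') x y.
Proof.
move/subsetP=> sub; apply: connect_sub => u v /and3P[uA vA uv].
by apply: connect1; apply/and3P; split=> //; apply: sub.
Qed.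

Section Caterpillar.
Variables (n : nat) (n_gt1 : 1 < n).
Notation C := (caterpillar n_gt1).
Implicit Types (u v w : vertex C) (S B : {set vertex C}).

(** The descendants, itself included, of the internal vertex at distance [c]
    from the root. *)
Definition below (c : nat) v : bool :=
  match v with inl a => c <= a | inr b => c <= minn b n.-2 end.

(** The edge above [inl c] is the only one between the descendants of [inl c]
    and the other vertices. *)
Lemma below_entry (c : 'I_n.-1) u v :
  adj C u v -> ~~ below c u -> below c v -> v = inl c.
Proof.
case: u v => [a|a] [b|b] //= /orP[] //= /eqP h ca cb; try by lia.
by congr inl; apply: val_inj => /=; lia.
Qed.

Lemma connect_below S (c : 'I_n.-1) u v : connect (within (adj C) S) u v ->
  ~~ below c u -> below c v -> inl c \in S.
Proof.
case/connectP => p; elim: p u => [|w p IH] u /=.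
  by move=> _ -> /negP.
case/andP=> /and3P[_ wS uw] pw lv nu bv.
case bw: (below c w); last by apply: IH pw lv _ bv; rewrite bw.
by rewrite -(below_entry uw nu bw).
Qed.

(** The vertex set of the path from [inl r] down to its descendant [v]. *)
Definition segment (r : nat) v : {set vertex C} :=
  [set w : vertex C |
    if (w : cat_vertex n) is inl c then (r <= c) && below c v else w == v].

(** Climb from [v] to its parent until [inl r] is reached. *)
Lemma segment_connect (r : 'I_n.-1) v :
  below r v -> connect (within (adj C) (segment r v)) (inl r) v.
Proof.
move ed: (cat_depth v) => d; elim: d v ed => [|d IH] v ed bv.
  have e := cat_depth0 n_gt1 ed.
  have e' : r = 0 :> nat by move: bv; rewrite e /=; lia.
  by rewrite (_ : inl r = v) // e; congr inl; apply: val_inj.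
case: (eqVneq v (inl r)) => [->//|nv].
have [|u uv] := @cat_parent_ex _ n_gt1 v; first by rewrite ed.
have du : cat_depth u = d.
  by have := cat_parent_depth n_gt1 uv; rewrite ed => -[].
have bu : below r u.
  move: bv nv uv; case: (v) (u) => [a|a] [b|b] //= bv nv /eqP uv;
    have := ltn_ord b; try lia.
  have : (a : nat) <> r by move=> e; case/eqP: nv; congr inl; apply: val_inj.
  lia.
apply: (@connect_trans _ _ u).
  apply: connect_within_subset (IH u du bu); apply/subsetP => z.
  move: uv; rewrite !inE; case: (u) (v) z => [a|a] [b|b] [z|z] //= /eqP uv;
    have := ltn_ord a; lia.
apply: connect1; apply/and3P; split; last by apply/orP; left.
all: rewrite inE; move: uv bu bv.
all: case: (u) (v) => [a|a] [b|b] //= /eqP uv; rewrite ?eqxx //.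
all: by have := ltn_ord a; lia.
Qed.

Lemma hull_connected B S u v : u \in hull B -> v \in hull B ->
  B \subset S -> connected_in (adj C) S ->
  [/\ u \in S, v \in S & connect (within (adj C) S) u v].
Proof.
move=> uh vh BS cS.
have sub : hull B \subset S by apply: bigcap_inf; rewrite BS.
have [uS vS] := (subsetP sub _ uh, subsetP sub _ vh).
by split=> //; move/forall_inP: cS => /(_ u uS) /forall_inP /(_ v vS).
Qed.

(** A connected set with a vertex on each side of the edge above [inl c]
    contains [inl c]. *)
Lemma hull_segment B (r : 'I_n.-1) v : inl r \in hull B -> v \in hull B ->
  segment r v \subset hull B.
Proof.
move=> rh vh; apply/subsetP => w wv; apply/bigcapP => S /andP[BS cS].
have [rS vS rv] := hull_connected rh vh BS cS.
move: wv; rewrite inE; case: w => [c|c /eqP -> //] /andP[rc cv].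
case: (eqVneq c r) => [->//|ncr].
apply: connect_below rv _ cv.
by rewrite /= -ltnNge ltn_neqAle rc andbT eq_sym.
Qed.

(** A leaf has only one neighbour, through which every walk leaves it. *)
Lemma hull_parent B (b : 'I_n) v (a : 'I_n.-1) :
  inr b \in hull B -> v \in hull B -> v != inr b ->
  a = minn b n.-2 :> nat -> inl a \in hull B.
Proof.
move=> bh vh nvb ea; apply/bigcapP => S /andP[BS cS].
have [bS vS /connectP[[|w p] /= ]] := hull_connected bh vh BS cS.
  by move=> _ ev; rewrite ev eqxx in nvb.
case/andP=> /and3P[_ wS bw] _ _.
suff -> : inl a = w by [].
move: bw; case: (w) => [c|c] /orP[] //= /eqP ec.
by congr inl; apply: val_inj; rewrite /= ea ec.
Qed.

Lemma hull_rootP B : B != set0 ->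
  hull_root B \in hull B /\
  forall v, v \in hull B -> cat_depth (hull_root B) <= cat_depth v.
Proof.
case/set0Pn=> b bB; rewrite /hull_root; case: arg_minnP => [|x xh xmin].
  case: pickP => [c cB|/(_ b)]; last by rewrite bB.
  exact: (subsetP (sub_hull _)).
by split=> // v /xmin; rewrite !caterpillar_depth.
Qed.

(** The second leaf matters: with a single leaf the hull is that leaf, which is
    then its root. *)
Lemma hull_root_spine B (b b' : 'I_n) : B != set0 -> b != b' ->
  inr b \in hull B -> inr b' \in hull B ->
  exists2 r : 'I_n.-1, hull_root B = inl r & r <= minn b n.-2.
Proof.
move=> B0 bb' bh b'h; have [rh rmin] := hull_rootP B0.
have par (c : 'I_n) : minn c n.-2 < n.-1 by have := n_gt1; lia.
have other c : inr c \in hull B -> exists2 v, v \in hull B & v != inr c.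
  move=> ch; case: (eqVneq b c) => [<-|nbc]; last by exists (inr b).
  by exists (inr b') => //; apply: contraNneq bb' => -[->].
have up c : inr c \in hull B -> cat_depth (hull_root B) <= minn c n.-2.
  move=> ch; have [v vh vc] := other c ch.
  by have := rmin _ (hull_parent ch vh vc (erefl (Ordinal (par c) : nat))).
have := up b bh; move: rh up; case: (hull_root B) => [r|c] rh up rb.
  by exists r.
(* A leaf is one deeper than its parent, which is in the hull. *)
by have := up c rh; rewrite /=; have := ltn_ord c; lia.
Qed.

End Caterpillar.

(** * Cut vertices under suppression and isomorphism *)

Section Suppression.
Variables (T : rooted_graph) (B : {set vertex T}) (B0 : B != set0).
Notation K := (induced_subtree B0).
Implicit Types x u v : vertex K.

(** An edge of the induced subtree is a path through suppressed vertices, none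
    of which is the kept vertex [x]. *)
Lemma induced_connectW x u v : connect (within (adj K) (~: [set x])) u v ->
  connect (within (adj T) (~: [set val x])) (val u) (val v).
Proof.
case/connectP => p; elim: p u => [|w p IH] u /=; first by move=> _ ->.
case/andP=> /and3P[ux wx uw] pw lv; apply: connect_trans (IH w pw lv).
case/andP: uw => _; apply: connect_within_subset; apply/subsetP => t.
move: ux wx; rewrite !inE => ux wx /orP[/orP[]/eqP->|]; rewrite ?val_eqE //.
apply: contraTneq => ->; have := valP x; rewrite !inE => /andP[nx xh].
exact: nx.
Qed.

(** The kept vertices met by a walk of the hull are successively adjacent in the
    induced subtree. *)
Lemma induced_connect x u v : u != x ->
  connect (within (adj T) (hull B :\ val x)) (val u) (val v) ->
  connect (within (adj K) (~: [set x])) u v.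
Proof.
move=> ux /connectP[p].
(* [u] stands for the last kept vertex met so far, and [y] for the current
   vertex, reached from [u] through suppressed vertices. *)
suff gen y : y \in val u |: suppressed B ->
    connect (within (adj T) (val u |: suppressed B)) (val u) y ->
    path (within (adj T) (hull B :\ val x)) y p -> val v = last y p ->
    connect (within (adj K) (~: [set x])) u v.
  by apply: gen; rewrite // !inE eqxx.
elim: p y u ux => [|z p IH] y u ux yu uy /=.
  move=> _ ev; move: yu; rewrite -ev in_setU1 => /orP[/eqP/val_inj -> //|vs].
  by have := valP v; rewrite inE vs.
case/andP=> /and3P[yh zh yz] pz lv.
have [zx zhull] : z != val x /\ z \in hull B.
  by move: zh; rewrite !inE => /andP[].
have [zs|zs] := boolP (z \in suppressed B).
  have zu : z \in val u |: suppressed B by rewrite inE zs orbT.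
  apply: IH pz lv => //; apply: connect_trans uy (connect1 _).
  by apply/and3P; split.
have zK : z \in kept B by rewrite inE zs.
pose w : vertex K := Sub z zK.
have uw : connect (within (adj K) (~: [set x])) u w.
  case: (eqVneq u w) => [->//|nuw]; apply: connect1.
  have wx : w != x by rewrite -val_eqE.
  apply/and3P; split; [by rewrite !inE | by rewrite !inE |].
  apply/andP; split; first by rewrite val_eqE.
  have sub : val u |: suppressed B \subset [set val u; z] :|: suppressed B.
    by rewrite setSU // subsetUl.
  apply: connect_trans (connect_within_subset sub uy) (connect1 _).
  by apply/and3P; split=> //; [exact: (subsetP sub) | rewrite !inE eqxx orbT].
apply: connect_trans uw (IH z w _ _ _ pz _) => //.
by rewrite !inE eqxx.
Qed.

End Suppression.

Lemma connect_avoid_morph (T1 T2 : rooted_graph)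
    (f : vertex T1 -> vertex T2) x u v :
  injective f -> (forall y z, adj T2 (f y) (f z) = adj T1 y z) ->
  connect (within (adj T1) (~: [set x])) u v ->
  connect (within (adj T2) (~: [set f x])) (f u) (f v).
Proof.
move=> fi fa /connectP[p]; elim: p u => [|w p IH] u /=; first by move=> _ ->.
case/andP=> uw pw lv; apply: connect_trans (connect1 _) (IH w pw lv).
by case/and3P: uw => ux wx uw; apply/and3P; split;
  rewrite ?fa // in_setC1 (inj_eq fi) -in_setC1.
Qed.

Lemma connect_avoid_iso (T1 T2 : rooted_graph)
    (f : vertex T1 -> vertex T2) x u v : rooted_iso f ->
  connect (within (adj T2) (~: [set f x])) (f u) (f v) =
  connect (within (adj T1) (~: [set x])) u v.
Proof.
case=> -[g fK gK] fa _; apply/idP/idP; last first.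
  by apply: connect_avoid_morph => //; exact: can_inj fK.
move=> h; rewrite -[x]fK -[u]fK -[v]fK; apply: connect_avoid_morph h.
  exact: can_inj gK.
by move=> y z; rewrite -fa !gK.
Qed.

(** * Induced subtanglegrams preserve strict inversions *)

(** The vertex [x0] below the parent of [k] separates the root from [l] but not
    from [k], and so does its image [f x0] in the hull. Hence [f x0] lies on the
    path from the root of the hull to the leaf [b] and not on the one to [a],
    which is possible only if [a] leaves the spine above [f x0] and [b] does
    not. The minima identify the two lowest leaves, which have the same parent;
    with leaves numbered from 0, [minn k n.-2] is the depth of the parent of
    the leaf [k]. *)
Lemma leaf_order_embedding (n m : nat) (n_gt1 : 1 < n) (m_gt1 : 1 < m)
    (B : {set vertex (caterpillar m_gt1)}) (B0 : B != set0)
    (f : vertex (caterpillar n_gt1) -> vertex (induced_subtree B0))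
    (k l : 'I_n) (a b : 'I_m) : rooted_iso f ->
  val (f (inr k)) = inr a -> val (f (inr l)) = inr b ->
  minn k n.-2 < minn l n.-2 -> minn a m.-2 < minn b m.-2.
Proof.
move=> fiso fk fl kl.
have fi : injective f by case: fiso => /bij_inj.
have fr : val (f (root (caterpillar n_gt1))) = hull_root B.
  by case: fiso => _ _ ->.
have k1 : k.+1 < n.-1 by have := n_gt1; lia.
pose x0 : vertex (caterpillar n_gt1) := inl (Ordinal k1).
have con : connect (within (adj _) (~: [set x0])) (root _) (inr k).
  have := @segment_connect _ n_gt1 (Ordinal (cat_root_proof n_gt1)) (inr k) isT.
  apply: connect_within_subset; apply/subsetP => t.
  by rewrite !inE; apply: contraTneq => -> /=; lia.
have sep : ~~ connect (within (adj _) (~: [set x0])) (root _) (inr l).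
  apply/negP => /(connect_below (c := Ordinal k1)) /(_ isT).
  by rewrite !inE eqxx => /(_ ltac:(rewrite /=; lia)).
rewrite -(connect_avoid_iso _ _ _ fiso) in con.
rewrite -(connect_avoid_iso _ _ _ fiso) in sep.
have {con} := induced_connectW con; rewrite fr fk => con.
have rx : f (root _) != f x0 by rewrite (inj_eq fi); apply/eqP => -[].
have {sep} := contra (induced_connect rx) sep; rewrite fr fl => sep.
have fh v : val (f v) \in hull B by have := valP (f v); rewrite inE => /andP[].
have nab : b != a.
  apply: contraTneq kl => eab; rewrite -leqNgt.
  have : f (inr k) = f (inr l) by apply: val_inj; rewrite fk fl eab.
  by case/fi => ->.
have ah : inr a \in hull B by rewrite -fk.
have bh : inr b \in hull B by rewrite -fl.
have [r er rb] := hull_root_spine B0 nab bh ah.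
have rh : inl r \in hull B by rewrite -er -fr.
have : val (f x0) \in @segment m m_gt1 r (inr b).
  apply: contraR sep => xs; rewrite er.
  apply: connect_within_subset
    (segment_connect (n_gt1 := m_gt1) (v := inr b) rb).
  apply/subsetP => t ts.
  rewrite in_setD1 (subsetP (hull_segment rh bh) _ ts) andbT.
  by apply: contraTneq ts => ->.
rewrite inE; case ex: (val (f x0)) => [c|c] /=; last first.
  by rewrite -ex -fl val_eqE (inj_eq fi).
case/andP=> rc cb; apply: leq_trans cb; rewrite ltnNge; apply/negP => ca.
have {}rc : r < c.
  rewrite ltn_neqAle rc andbT; apply: contra rx => /eqP/val_inj erc.
  by apply/eqP; apply: val_inj; rewrite fr er ex erc.
rewrite er ex in con.
by have := connect_below (c := c) con;
  rewrite !inE eqxx /= -ltnNge => /(_ rc ca).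
Qed.

(** The inversions of [pi] which do not depend on the order of the two lowest
    leaves in either caterpillar: [k] hangs strictly above [l] on the left, and
    the partner of [l] strictly above that of [k] on the right. *)
Definition strict_inversion n (pi : 'S_n) (k l : 'I_n) : bool :=
  (minn k n.-2 < minn l n.-2) && (minn (pi l) n.-2 < minn (pi k) n.-2).

Lemma induced_sub_inversions n m (n_gt1 : 1 < n) (m_gt1 : 1 < m)
    (pi : 'S_n) (sigma : 'S_m) :
  induced_sub (catergram n_gt1 pi) (catergram m_gt1 sigma) ->
  exists2 phi : 'I_n -> 'I_m, injective phi &
    forall k l, strict_inversion pi k l ->
      strict_inversion sigma (phi k) (phi l).
Proof.
case=> M' [sM [M0 [f [g [fiso giso fgM]]]]].
have ex k : exists a,
    val (f (inr k)) = inr a /\ val (g (inr (pi k))) = inr (sigma a).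
  have : (inr k, inr (pi k)) \in cat_matching n_gt1 pi by rewrite inE.
  rewrite -fgM inE => /(subsetP sM); rewrite inE /=.
  by case: (val (f _)) (val (g _)) => [a|a] [b|b] // /eqP <-; exists a.
have [phi phiP] := fin_all_exists ex.
exists phi => [k l e|k l /andP[kl pkl]].
  have : f (inr k) = f (inr l) by apply: val_inj; rewrite !(proj1 (phiP _)) e.
  by case: fiso => /bij_inj fi _ _ /fi [].
have [[fk gk] [fl gl]] := (phiP k, phiP l).
apply/andP; split; first exact: leaf_order_embedding fiso fk fl kl.
exact: leaf_order_embedding giso gl gk pkl.
Qed.

(** * The double broom of rho *)

(** Positions are numbered from 0, so that the first hub is the position 3 of
    the value 0, and the last hub is the last position. *)
Definition hub (i t : nat) : nat := if t < i + 3 then 2 * t + 3 else 11 + 2 * i.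

(** The neighbours [k] of the hub of index [t]; the odd ones are the additional
    pendant vertices at the two end hubs. *)
Definition edge (i k t : nat) : Prop :=
  k = 2 * t \/ k = 2 * t + 2 \/ t = 0 /\ k = 1 \/ t = i + 3 /\ k = 2 * i + 9.

(** The graph of [rho i], with positions and values numbered from 0, in a form
    suited to case analysis. *)
Variant rho_spec (i : nat) : nat -> nat -> Prop :=
  | RhoInit k of k <= 1 : rho_spec i k k.+1
  | RhoUp s of 1 <= s <= i + 3 : rho_spec i (2 * s) (2 * s + 2)
  | RhoFirst : rho_spec i 3 0
  | RhoDown s of 1 <= s <= i + 2 : rho_spec i (2 * s + 3) (2 * s + 1)
  | RhoFinal k of 8 + 2 * i <= k <= 10 + 2 * i : rho_spec i k k.+1
  | RhoLast : rho_spec i (11 + 2 * i) (7 + 2 * i).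

Lemma rhoP i (k : 'I_(12 + 2 * i)) : rho_spec i k (rho i k).
Proof.
move ev : (val (rho i k)) => v; move: ev; rewrite permE /= /rho_val.
have -> : odd k.+1 = (k.+1 %% 2 == 1) by rewrite modn2; case: odd.
move: (ltn_ord k); move: (nat_of_ord k) => {}k kn ev.
have [k1|k1] := leqP k 1.
  have -> : v = k.+1 by rewrite -ev; repeat (case: ifP => ?); lia.
  exact: RhoInit.
have [k8|k8] := leqP (8 + 2 * i) k.
  have [ek|nk] := eqVneq k (11 + 2 * i).
    have -> : v = 7 + 2 * i by rewrite -ev; repeat (case: ifP => ?); lia.
    rewrite ek; exact: RhoLast.
  have -> : v = k.+1 by rewrite -ev; repeat (case: ifP => ?); lia.
  by apply: RhoFinal; lia.
have [e|e] := eqVneq (k %% 2) 0.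
  have ek : k = 2 * (k %/ 2) by lia.
  have -> : v = 2 * (k %/ 2) + 2 by rewrite -ev; repeat (case: ifP => ?); lia.
  by rewrite {1}ek; apply: RhoUp; lia.
have [ek|nk] := eqVneq k 3.
  have -> : v = 0 by rewrite -ev; repeat (case: ifP => ?); lia.
  rewrite ek; exact: RhoFirst.
have ek : k = 2 * ((k - 3) %/ 2) + 3 by lia.
have -> : v = 2 * ((k - 3) %/ 2) + 1.
  by rewrite -ev; repeat (case: ifP => ?); lia.
by rewrite {1}ek; apply: RhoDown; lia.
Qed.

Lemma strict_inversion_rho i (k l : 'I_(12 + 2 * i)) :
  strict_inversion (rho i) k l <->
  exists t, [/\ t <= i + 3, l = hub i t :> nat & edge i k t].
Proof.
rewrite /strict_inversion /edge; have [kP lP] := (rhoP k, rhoP l).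
move: (nat_of_ord (rho i k)) (nat_of_ord (rho i l)) kP lP => v w.
move: (nat_of_ord k) (nat_of_ord l) => {}k {}l kP lP; split.
  (* Unless [l] is the first hub, an inner one or the last one, no earlier value
     is greater than the value at [l]. *)
  move=> inv; case: lP inv => [l' l1|s s3||s s2|l' l8|] inv;
    try by move: inv; case: kP => *; lia.
  - exists 0; split=> //; first by rewrite /hub addn3.
    by move: inv; case: kP => *; lia.
  - exists s; split; [lia | by rewrite /hub; case: ifP => ?; lia |].
    by move: inv; case: kP => *; lia.
  - exists (i + 3); split=> //; first by rewrite /hub ltnn.
    by move: inv; case: kP => *; lia.
case=> t [ti el ek]; move: el; rewrite /hub.
by case: ifP => ? el; move: el; case: lP => *; try lia; case: kP ek => *; lia.
Qed.

Lemma hub_inj i s t : s <= i + 3 -> t <= i + 3 -> hub i s = hub i t -> s = t.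
Proof. by rewrite /hub; case: ifP => ?; case: ifP => ?; lia. Qed.

Lemma hub_lt i t : hub i t < 12 + 2 * i.
Proof. by rewrite /hub; case: ifP => ?; lia. Qed.

Lemma edge_lt i k t : t <= i + 3 -> edge i k t -> k < 12 + 2 * i.
Proof. by rewrite /edge; lia. Qed.

(** Two hubs with a common neighbour are consecutive on the path of hubs. *)
Lemma hub_step i s t k : s <= i + 3 -> t <= i + 3 -> s <> t ->
  edge i k s -> edge i k t -> s = t.+1 \/ t = s.+1.
Proof. by rewrite /edge; lia. Qed.

(** An inner hub has only two neighbours. *)
Lemma hub_end i t a b c : edge i a t -> edge i b t -> edge i c t ->
  a <> b -> a <> c -> b <> c -> t = 0 \/ t = i + 3.
Proof. by rewrite /edge; lia. Qed.

(** * Comparing two double brooms *)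

(** A walk on the line that never returns to a visited point cannot turn. *)
Lemma line_walk (m : nat) (u : nat -> nat) :
  (forall t, t < m -> u t = (u t.+1).+1 \/ u t.+1 = (u t).+1) ->
  (forall s t, s <= m -> t <= m -> u s = u t -> s = t) ->
  u m = u 0 + m \/ u 0 = u m + m.
Proof.
move=> step inj.
suff [up|down] : (forall t, t <= m -> u t = u 0 + t) \/
                 (forall t, t <= m -> u 0 = u t + t).
- by left; apply: up.
- by right; apply: down.
case: (posnP m) => [->|m0].
  by left=> t; rewrite leqn0 => /eqP ->; rewrite addn0.
have turn t : t.+2 <= m -> u t <> u t.+2.
  by move=> tm /inj -/(_ (ltnW (ltnW tm)) tm); lia.
have [d|d] := step 0 m0; [right | left].
- have down t : t < m -> u t = (u t.+1).+1.
    elim: t => // t IH tm; have := turn t tm; have := IH (ltnW tm).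
    by case: (step _ tm) => ->; lia.
  by elim=> [|t IH] tm; [lia | have := down t tm; have := IH (ltnW tm); lia].
- have up t : t < m -> u t.+1 = (u t).+1.
    elim: t => // t IH tm; have := turn t tm; have := IH (ltnW tm).
    by case: (step _ tm) => ->; lia.
  by elim=> [|t IH] tm; [lia | have := up t tm; have := IH (ltnW tm); lia].
Qed.

Theorem theorem14 (i j : nat) (hi : 0 < i) (hj : 0 < j) (hij : i <> j) :
  ~ induced_sub (rho_catergram i) (rho_catergram j).
Proof.
case/induced_sub_inversions => phi phi_inj phi_inv; apply: hij.
pose pos k : 'I_(12 + 2 * i) := @inord (11 + 2 * i) k.
have posK k : k < 12 + 2 * i -> pos k = k :> nat by exact: inordK.
pose F k : nat := phi (pos k).
have F_inj k l : k < 12 + 2 * i -> l < 12 + 2 * i -> F k = F l -> k = l.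
  by move=> kn ln /val_inj/phi_inj/(congr1 val); rewrite /= !posK.
have F_edge k t : t <= i + 3 -> edge i k t ->
    exists s, [/\ s <= j + 3, F (hub i t) = hub j s & edge j (F k) s].
  move=> ti kt; apply/strict_inversion_rho/phi_inv/strict_inversion_rho.
  by exists t; rewrite !posK ?hub_lt ?(edge_lt ti kt).
have hub_to (t : 'I_(i + 3).+1) : exists s,
    [/\ s <= j + 3, F (hub i t) = hub j s
    & forall k, edge i k t -> edge j (F k) s].
  have ti : t <= i + 3 by rewrite -ltnS.
  have [|s [sj es _]] := F_edge (2 * t) t ti; first by left.
  exists s; split=> // k /(F_edge _ _ ti)[s' [s'j es']].
  by rewrite (hub_inj sj s'j) // -es.
(* [u t] is the index of the hub of [rho j] to which the hub [t] is sent. *)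
have [u' u'P] := fin_all_exists hub_to.
pose u t := u' (@inord (i + 3) t).
have uP t : t <= i + 3 -> [/\ u t <= j + 3, F (hub i t) = hub j (u t)
    & forall k, edge i k t -> edge j (F k) (u t)].
  by move=> ti; have := u'P (inord t); rewrite inordK.
have u_inj s t : s <= i + 3 -> t <= i + 3 -> u s = u t -> s = t.
  move=> si ti e; apply: (hub_inj si ti); apply: F_inj; rewrite ?hub_lt //.
  by have [[_ -> _] [_ -> _]] := (uP s si, uP t ti); rewrite e.
have step t : t < i + 3 -> u t = (u t.+1).+1 \/ u t.+1 = (u t).+1.
  (* [2 * t + 2] is the common neighbour of the hubs [t] and [t.+1]. *)
  move=> ti; have [[b e Fe] [b' e' Fe']] := (uP t (ltnW ti), uP t.+1 ti).
  apply: (hub_step (k := F (2 * t + 2)) b b').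
  - by move/(u_inj _ _ (ltnW ti) ti); lia.
  - by apply: Fe; rewrite /edge; lia.
  - by apply: Fe'; rewrite /edge; lia.
have ends t : t = 0 \/ t = i + 3 -> u t = 0 \/ u t = j + 3.
  move=> et; have ti : t <= i + 3 by lia.
  have [_ _ Fe] := uP t ti.
  have [x e3 x_odd] : exists2 x, edge i x t & x %% 2 = 1.
    by case: et => ->; [exists 1 | exists (2 * i + 9)]; rewrite /edge; lia.
  have e1 : edge i (2 * t) t by left.
  have e2 : edge i (2 * t + 2) t by right; left.
  have neq k l : edge i k t -> edge i l t -> k <> l -> F k <> F l.
    move=> ek el nkl e; apply: nkl.
    exact: F_inj (edge_lt ti ek) (edge_lt ti el) e.
  by apply: (hub_end (Fe _ e1) (Fe _ e2) (Fe _ e3)); apply: neq => //; lia.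
have := line_walk step u_inj; have := ends 0 (or_introl erefl).
have := ends (i + 3) (or_intror erefl); lia.
Qed.
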